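(* Let $\alpha>0$ and $f\in\mathcal{A}^\alpha$. Let $Y^n=(Y_1^n,\dots,Y_n^n)$, $n\in\mathbb{N}$, be observations from the regression model described in the context with noise satisfying Condition (A) with constant $\beta$, let $(\gamma_n)_{n\in\mathbb{N}}$ be a (possibly random) sequence of smoothing parameters, and let $\hat f_n\in\iota^n(\arg\min H_{\gamma_n}(\cdot,Y^n))$. Suppose that, for some $\delta>0$, $\mathbb{P}$-almost surely $\gamma_n\to0$ and $\gamma_n\ge(1+\delta)\,12\beta\,\frac{\log n}{n}$ for all but finitely many $n$. Then $$\|\hat f_n-f\|=O\left(\gamma_n^{\alpha/(2\alpha+1)}\right)\quad\mathbb{P}\text{-almost surely}.$$
   Context: $\|\cdot\|$ is the norm of $L^2([0,1))$. Regression model: for each $n$, with $x_i^n=i/n$ ($0\le i\le n$), one observes $Y_i^n=\overline f_i^n+\xi_i^n$, $i=1,\dots,n$, where $\overline f_i^n=(x_i^n-x_{i-1}^n)^{-1}\int_{x_{i-1}^n}^{x_i^n}f(u)\,du$. Condition (A) on the triangular array of noise variables $(\xi_i^n)_{n\in\mathbb{N},1\le i\le n}$ (zero-mean, defined on a common probability space with measure $\mathbb{P}$): (i) for every $n$ the random variables $(\xi_i^n)_{1\le i\le n}$ are independent; (ii) there is a universal constant $\beta\in\mathbb{R}$ such that $\mathbb{E}e^{\nu\xi_i^n}\le e^{\beta\nu^2}$ for all $\nu\in\mathbb{R}$, $1\le i\le n$, $n\in\mathbb{N}$. Potts functional: for $u,Y\in\mathbb{R}^n$, $H_\gamma(u,Y)=\frac1n\sum_{i=1}^n(u_i-Y_i)^2+\gamma\cdot\#\{i:1\le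 i\le n-1,\ u_i\ne u_{i+1}\}$. The set of minimizers over $u\in\mathbb{R}^n$ is denoted $\arg\min H_\gamma(\cdot,Y)$; it need not be a singleton, and $\hat f_n$ comes from any choice of minimizer. Embedding: $\iota^n:\mathbb{R}^n\to L^2([0,1))$, $\iota^n((u_1,\dots,u_n))=\sum_{i=1}^nu_i\mathbf{1}_{[(i-1)/n,i/n)}$. $S([0,1))$ is the space of right-continuous step functions $\sum_{i=1}^m\alpha_i\mathbf{1}_{[t_i,t_{i+1})}$, $\alpha_i\in\mathbb{R}$, $0=t_1<\dots<t_{m+1}=1$, $m\in\mathbb{N}$. For $g\in S([0,1))$, $J(g)=\{t\in(0,1):g(t-)\ne g(t+)\}$. Approximation error: $\Delta_k(f)=\inf\{\|g-f\|:g\in S([0,1)),\ \#J(g)\le k\}$. Approximation spaces: $\mathcal{A}^\alpha=\{f\in L^\infty[0,1]:\sup_{k\ge1}k^\alpha\Delta_k(f)<\infty\}$ for $\alpha>0$. ''$O(\cdot)$ $\mathbb{P}$-almost surely'' means that almost surely the ratio is bounded in $n$ (with a possibly random bound).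
   Formalization: The constant β of Condition (A) is assumed positive; for β = 0 (no noise) the claim fails, e.g. f the indicator of [0,θ) with θ irrational and γ_n = e^{-n}, while β < 0 is impossible. *)

(* Defs.v *)
(* MathComp-Analysis *)
From mathcomp Require Export all_boot all_order all_algebra.
From mathcomp Require Export all_classical all_reals all_analysis.

Set Implicit Arguments.
Unset Strict Implicit.
Unset Printing Implicit Defensive.

Import Order.TTheory GRing.Theory Num.Theory numFieldNormedType.Exports.

Local Open Scope classical_set_scope.
Local Open Scope ring_scope.

(* A function on [0,1) is represented by a function on R that is cut off to 0
   outside [0,1) before taking norms: its values there are irrelevant. *)
Definition L2norm (R : realType) (h : R -> R) : \bar R :=
  'N[@lebesgue_measure R]_2%:E[EFin \o (h \_ `[0, 1[)].

Definition Linfty01 (R : realType) (f : R -> R) : Prop :=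
  f \_ `[0, 1[ \in Lfun (@lebesgue_measure R) +oo%E.

Definition step_fun (R : realType) (g : R -> R) : Prop :=
  exists (m : nat) (t alpha : nat -> R),
    [/\ t 0%N = 0, t m = 1, forall i, (i < m)%N -> t i < t i.+1
      & g = (fun x => \sum_(i < m) alpha i * \1_`[t i, t i.+1[ x)].

Definition jumps (R : realType) (g : R -> R) : set R :=
  [set t | 0 < t < 1 /\ lim (g @ t^'-) != lim (g @ t^'+)].

(* [`I_k] is the set of naturals below [k]: the condition says that [jumps g]
   is finite with at most [k] elements. *)
Definition approx_err (R : realType) (k : nat) (f : R -> R) : \bar R :=
  ereal_inf [set L2norm (g \- f) | g in
    [set g | step_fun g /\ (jumps g #<= `I_k)%card]].

Definition approx_space (R : realType) (alpha : R) (f : R -> R) : Prop :=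
  Linfty01 f /\
  (ereal_sup [set (k%:R `^ alpha)%:E * approx_err k f | k in
    [set k | (1 <= k)%N]] < +oo)%E.

(* [grid R n i] is the design point i/n.  An index [i : 'I_n] stands for the
   1-based index i+1, hence for the cell with end points i/n and (i+1)/n. *)
Definition grid (R : realType) (n i : nat) : R := i%:R / n%:R.

Definition cell_mean (R : realType) (f : R -> R) (n : nat) (i : 'I_n) : R :=
  (grid R n i.+1 - grid R n i)^-1 *
  (\int[@lebesgue_measure R]_(u in `[grid R n i, grid R n i.+1]) f u)%R.

Definition embed (R : realType) (n : nat) (u : 'rV[R]_n) : R -> R :=
  fun x => \sum_(i < n) u 0 i * \1_`[grid R n i, grid R n i.+1[ x.

Definition nb_jumps (R : realType) (n : nat) (u : 'rV[R]_n) : nat :=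
  #|[set i : 'I_n | [exists j : 'I_n, (j == i.+1 :> nat) && (u 0 i != u 0 j)]]|.

Definition potts (R : realType) (n : nat) (gamma : R) (u Y : 'rV[R]_n) : R :=
  n%:R^-1 * (\sum_(i < n) (u 0 i - Y 0 i) ^+ 2) + gamma * (nb_jumps u)%:R.

Definition argmin_potts (R : realType) (n : nat) (gamma : R) (Y : 'rV[R]_n) :
  set 'rV[R]_n := [set u | forall v, potts gamma u Y <= potts gamma v Y].

Definition indep_RVs d (Omega : measurableType d) (R : realType)
    (P : probability Omega R) (I : finType) (X : I -> {RV P >-> R}) : Prop :=
  forall (J : {set I}) (B : I -> set R), (forall i, measurable (B i)) ->
    (P (\bigcap_(i in [set` J]) X i @^-1` B i) =
     \prod_(i in J) P (X i @^-1` B i))%E.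

Definition conditionA d (Omega : measurableType d) (R : realType)
    (P : probability Omega R) (xi : forall n : nat, 'I_n -> {RV P >-> R})
    (beta : R) : Prop :=
  [/\ forall n i, ('E_P[xi n i] = 0)%E,
      forall n, indep_RVs (xi n)
    & forall n i (nu : R), ('M_P (xi n i) nu <= (expR (beta * nu ^+ 2))%:E)%E].

Definition observation d (Omega : measurableType d) (R : realType)
    (P : probability Omega R) (xi : forall n : nat, 'I_n -> {RV P >-> R})
    (f : R -> R) (n : nat) (w : Omega) : 'rV[R]_n :=
  \row_(i < n) (cell_mean f i + xi n i w).

(* Main.v *)
From HB Require Import structures.
Require Import Defs.
From mathcomp Require Import measurable_realfun ess_sup_inf zify ring lra.
Import Order.TTheory GRing.Theory Num.Theory numFieldNormedType.Exports.
Local Open Scope classical_set_scope.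
Local Open Scope ring_scope.

(** A Potts minimizer [u] does at least as well as every competitor [v].
    Writing the data as cell means of [f] plus noise [xi], this says that the
    squared distance of [u] to the cell means plus [gamma] times its number of
    jumps is at most the same quantity for [v], up to [2 / n * <u - v, xi>].
    Since [u - v] is constant on [J(u) + J(v) + 1] segments, that inner product
    is controlled by the squared norm of [u - v] and by the largest normalised
    squared sum of the noise over a segment, times the number of segments
    ([noise_inner_product]).

    There are about [n ^ 2] segments, and a normalised sum of independent
    subgaussian variables exceeds [t] with probability at most [2 * exp (- t ^
    2 / (4 beta))] ([subgaussian_tail]; exponential moments of sums factor by
    [indep_integral_prod]). By the union bound and Borel-Cantelli, almost
    surely and for all large [n] no segment exceeds [t ^ 2 = (3 + e) * 4 beta *
    ln n] ([noise_eventually_small]). The assumed lower bound on [gamma n]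
    makes this a fraction [th < 1] of [n * gamma n]. So the noise cost of the
    jumps of [u] is covered by their penalty, and an oracle inequality remains
    ([potts_oracle]): the squared distance of [u] to the cell means is at most
    a constant times that of [v] plus [gamma * (J(v) + 1)], for every [v].

    The distances are turned into L2 distances to [f] by Pythagoras
    ([sqnorm_embed_decomposition]). For [f] in the approximation space, a step
    function with [k] jumps is at distance [O(k ^ - alpha)]; sampling it on the
    grid at most doubles the number of jumps and spoils at most [k] cells,
    where the boundedness of [f] limits the squared error to [O(k / n) =
    O(gamma * k)] ([discretize_approx]). Hence the squared error of the
    estimator is [O(k ^ - 2 alpha + gamma * k)], and [k] of order [gamma ^ - 1
    / (2 alpha + 1)] balances the two terms ([balanced_jumps], [potts_rate]).
    *)

Set Implicit Arguments.
Unset Strict Implicit.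
Unset Printing Implicit Defensive.

(** * The oracle inequality for Potts minimizers *)

Section piecewise.
Variable R : realFieldType.
Implicit Types (w x : nat -> R) (th T c : R).

(** Completing the square in [c]: the noise seen by a constant piece of length
    [m] acts only through its sum [S] over the piece, normalised by [m]. *)
Lemma constant_piece_noise th T c (S m : R) : 0 < th -> 0 < m ->
  S ^+ 2 <= m * T -> 2 * (c * S) <= th * (c ^+ 2 * m) + th^-1 * T.
Proof.
move=> th0 m0 ST.
have thm : 0 < th * m by rewrite mulr_gt0.
have h : th^-1 * S ^+ 2 / m <= th^-1 * T.
  by rewrite -mulrA ler_pM2l ?invr_gt0// ler_pdivrMr// mulrC.
apply: le_trans (lerD (lexx _) h).
have -> : th * (c ^+ 2 * m) + th^-1 * S ^+ 2 / m =
    (th * c * m - S) ^+ 2 / (th * m) + 2 * (c * S).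
  by field; rewrite !gt_eqF.
by rewrite lerDr divr_ge0 ?sqr_ge0// ltW.
Qed.

(** A sequence with [J] jumps is constant on [J + 1] segments, and each segment
    costs at most [T / th] on top of its share of the squared norm. The set of
    segments depends on the data, which is why the hypothesis controls the
    noise on all segments at once. *)
Lemma noise_inner_product w x th T n : 0 < th ->
  (forall a b, (a < b)%N -> (b <= n.+1)%N ->
    (\sum_(a <= i < b) x i) ^+ 2 <= (b - a)%:R * T) ->
  2 * \sum_(0 <= i < n.+1) w i * x i <=
  th * \sum_(0 <= i < n.+1) w i ^+ 2 +
  th^-1 * T * (\sum_(0 <= i < n) (w i != w i.+1)%:R + 1).
Proof.
move=> th0 ST.
have piece a b : (a < b)%N -> (b <= n.+1)%N ->
    (forall i, (a <= i < b)%N -> w i = w a) ->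
    2 * \sum_(a <= i < b) w i * x i <=
    th * \sum_(a <= i < b) w i ^+ 2 + th^-1 * T.
  move=> ab bn wa.
  rewrite (eq_big_nat _ _ (F2 := fun i => w a * x i)); last first.
    by move=> i /wa ->.
  rewrite -mulr_sumr (eq_big_nat _ _ (F1 := fun i => w i ^+ 2)
    (F2 := fun=> w a ^+ 2)); last first.
    by move=> i /wa ->.
  rewrite sumr_const_nat -[_ *+ (b - a)]mulr_natr.
  by apply: constant_piece_noise; rewrite ?ltr0n ?subn_gt0//; exact: ST.
have sum_cat (F : nat -> R) a b : (a < b)%N -> \sum_(0 <= i < b) F i =
    \sum_(0 <= i < a) F i + \sum_(a <= i < b) F i.
  by move=> ab; rewrite -big_cat_nat// ltnW.
(* [a] is the start of the last constant piece, which stays open until the next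
   jump *)
have last_piece m : (m < n.+1)%N -> exists a, [/\ (a < m.+1)%N,
    (forall i, (a <= i < m.+1)%N -> w i = w a) &
    2 * \sum_(0 <= i < a) w i * x i <=
    th * \sum_(0 <= i < a) w i ^+ 2 +
    th^-1 * T * (\sum_(0 <= i < m) (w i != w i.+1)%:R)].
  elim: m => [_|m IH mn].
    exists 0%N; split=> //; first by move=> i; rewrite ltnS leqn0 => /eqP->.
    by rewrite !big_geq// !mulr0 addr0.
  have [a [am wam ha]] := IH (ltnW mn).
  have [wE|wN] := eqVneq (w m) (w m.+1).
    exists a; split.
    - exact: ltnW.
    - move=> i /andP[ai]; rewrite ltnS leq_eqVlt => /predU1P[->|im].
        by rewrite -wE; apply: wam; rewrite -ltnS am ltnSn.
      by apply: wam; rewrite ai.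
    - by rewrite big_nat_recr//= wE eqxx addr0.
  exists m.+1; split=> //.
    by move=> i /andP[mi]; rewrite ltnS => im; congr w; apply/eqP;
      rewrite eqn_leq im.
  rewrite [X in th^-1 * T * X]big_nat_recr//= wN mulrDr mulr1.
  rewrite (sum_cat (fun i => w i * x i) _ _ am)
    (sum_cat (fun i => w i ^+ 2) _ _ am).
  by have := piece _ _ am (ltnW mn) wam; lra.
have [a [an wan ha]] := last_piece _ (ltnSn n).
rewrite (sum_cat (fun i => w i * x i) _ _ an)
  (sum_cat (fun i => w i ^+ 2) _ _ an).
by have := piece _ _ an (leqnn _) wan; lra.
Qed.

End piecewise.

Section oracle.
Variable R : realType.

Lemma sum_jumps_le_nb_jumps n (u : 'rV[R]_n.+1) :
  \sum_(0 <= i < n) (u 0 (inord i) != u 0 (inord i.+1))%:R <=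
  (nb_jumps u)%:R :> R.
Proof.
rewrite -natr_sum ler_nat /nb_jumps -sum1_card [leqRHS]big_mkcond/= big_mkord.
rewrite [leqRHS]big_ord_recr/=; apply: (leq_trans _ (leq_addr _ _)).
apply: leq_sum => i _.
set S := [set _ | _]%classic; have [Si|/negP Si] := boolP (_ \in in_set S).
  by case: (_ != _).
have /existsPn/(_ (inord i.+1)) : ~~ [exists j : 'I_n.+1, (j == i.+1 :> nat) &&
    (u 0 (widen_ord (leqnSn n) i) != u 0 j)].
  by apply/negP => h; apply: Si; apply/mem_set.
rewrite inordK ?ltnS// eqxx/= negbK.
rewrite -(_ : inord i = widen_ord (leqnSn n) i) => [->//|].
by apply/val_inj; rewrite /= inordK// ltnS ltnW.
Qed.

Lemma nb_jumpsB_le n (u v : 'rV[R]_n.+1) :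
  \sum_(0 <= i < n) ((u - v) 0 (inord i) != (u - v) 0 (inord i.+1))%:R <=
  (nb_jumps u)%:R + (nb_jumps v)%:R :> R.
Proof.
apply: le_trans (lerD (sum_jumps_le_nb_jumps u) (sum_jumps_le_nb_jumps v)).
rewrite -big_split/=; apply: ler_sum => i _.
rewrite -natrD ler_nat !mxE.
have [->|_] := eqVneq (u 0 (inord i)) _; last by rewrite (leq_trans (leq_b1 _)).
have [->|_] := eqVneq (v 0 (inord i)) _; last by rewrite leq_b1.
by rewrite eqxx.
Qed.

(** With the factor [1 / n] this is the squared L2 distance of the embeddings,
    that is, the data term of the Potts functional. *)
Definition sqdist n (u v : 'rV[R]_n) : R :=
  n%:R^-1 * \sum_(i < n) (u 0 i - v 0 i) ^+ 2.

(** Comparing the values of the functional at the minimizer [u] and at a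
    competitor [v] leaves the noise term [2 / n * <u - v, xi>]. When [T] is a
    proper fraction [th] of [n * gamma], the number of jumps of [u] that enters
    through this term is paid for by the penalty [gamma * nb_jumps u], and [th
    * |u - v|^2] is absorbed into the left-hand side since [th < 1]. *)
Lemma potts_oracle n (fbar xi u v : 'rV[R]_n) (gamma th T : R) :
  (0 < n)%N -> 0 < th < 1 -> T <= th * (n%:R * gamma) ->
  (forall (a b : nat), (a < b)%N -> (b <= n)%N ->
    (\sum_(i < n | (a <= i < b)%N) xi 0 i) ^+ 2 <= (b - a)%:R * T) ->
  argmin_potts gamma (fbar + xi) u ->
  sqdist u fbar <= 2 * (1 + th ^+ 2) / (1 - th) ^+ 2 * sqdist v fbar +
    2 / (1 - th) * (gamma * (2 * (nb_jumps v)%:R + 1)).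
Proof.
case: n fbar xi u v => // n fbar xi u v _ /andP[th0 th1] Tg ST /(_ v) uv.
pose N : R := n.+1%:R; have N0 : 0 < N by rewrite ltr0n.
have : 2 * \sum_(0 <= i < n.+1) (u - v) 0 (inord i) * xi 0 (inord i) <=
    th * \sum_(0 <= i < n.+1) (u - v) 0 (inord i) ^+ 2 +
    th^-1 * T * ((nb_jumps u)%:R + (nb_jumps v)%:R + 1).
  have T0 : 0 <= T.
    by have := ST 0%N 1%N isT isT; rewrite subn0 mul1r;
      apply: le_trans (sqr_ge0 _).
  apply: (le_trans (@noise_inner_product _ (fun i => (u - v) 0 (inord i))
    (fun i => xi 0 (inord i)) _ _ _ th0 _)).
    move=> a b ab bn; apply: le_trans (ST _ _ ab bn).
    rewrite (_ : bigop _ _ _ = \sum_(i < n.+1 | (a <= i < b)%N) xi 0 i)//.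
    rewrite (big_nat_widen _ _ n.+1)// (big_nat_widenl _ 0)// big_mkord.
    by apply: eq_big => i; rewrite ?inord_val// andbC.
  rewrite lerD2l ler_wpM2l ?mulr_ge0 ?invr_ge0 ?(ltW th0)// lerD2r.
  exact: nb_jumpsB_le.
rewrite !big_mkord; under eq_bigr do rewrite inord_val.
under [X in _ <= th * X + _]eq_bigr do rewrite inord_val.
move=> noise.
have T_le : th^-1 * T <= N * gamma by rewrite mulrC ler_pdivrMr// mulrC.
(* Young's inequality, with the weight that makes the coefficient of [sqdist u
   fbar] equal to [(1 + th) / 2] after multiplication by [th] *)
have sq_uv : n.+1%:R^-1 * (\sum_(i < n.+1) (u - v) 0 i ^+ 2) <=
   (1 + (1 - th) / (2 * th)) * sqdist u fbar +
   (1 + (2 * th) / (1 - th)) * sqdist v fbar.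
  rewrite /sqdist !(mulrCA _ n.+1%:R^-1) -mulrDr ler_pM2l ?invr_gt0//.
  rewrite !mulr_sumr -big_split/=; apply: ler_sum => i _; rewrite !mxE.
  set a := u 0 i - fbar 0 i; set b := v 0 i - fbar 0 i.
  have -> : u 0 i - v 0 i = a - b by rewrite /a /b; ring.
  rewrite -subr_ge0.
  have -> : (1 + (1 - th) / (2 * th)) * a ^+ 2 +
    (1 + 2 * th / (1 - th)) * b ^+ 2
      - (a - b) ^+ 2 = ((1 - th) * a + 2 * th * b) ^+ 2 / (2 * th * (1 - th)).
    by field; rewrite subr_eq0 !gt_eqF.
  by rewrite divr_ge0 ?sqr_ge0// ?mulr_ge0 ?subr_ge0 ?(ltW th0)// ltW.
move: uv; rewrite /potts.
have expand (z : 'rV[R]_n.+1) :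
    n.+1%:R^-1 * (\sum_(i < n.+1) (z 0 i - (fbar + xi) 0 i) ^+ 2) =
    sqdist z fbar - n.+1%:R^-1 * (2 * \sum_(i < n.+1) z 0 i * xi 0 i) +
    n.+1%:R^-1 * \sum_(i < n.+1) (2 * fbar 0 i * xi 0 i + xi 0 i ^+ 2).
  rewrite /sqdist -mulrN -!mulrDr; congr (_ * _).
  rewrite mulr_sumr -sumrN -!big_split/=; apply: eq_bigr => i _; rewrite !mxE;
    ring.
rewrite !expand => uv.
have n1_ge0 : 0 <= n.+1%:R^-1 :> R by rewrite invr_ge0.
move: (ler_wpM2l n1_ge0 noise).
under eq_bigr do rewrite !mxE mulrBl.
rewrite sumrB mulrBr mulrDr [in leRHS]mulrDr (mulrCA _ th) => noise'.
have jumpterm : n.+1%:R^-1 * (th^-1 * T * ((nb_jumps u)%:R + (nb_jumps v)%:R +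
  1)) <=
   gamma * ((nb_jumps u)%:R + (nb_jumps v)%:R + 1).
  rewrite mulrA ler_wpM2r ?addr_ge0//.
  by rewrite ler_pdivrMl.
have := ler_wpM2l (ltW th0) sq_uv.
move: noise' uv; rewrite -/N.
set E := sqdist u fbar; set F := sqdist v fbar => noise' uv sq_uv'.
have split_th : th * ((1 + (1 - th) / (2 * th)) * E +
  (1 + 2 * th / (1 - th)) * F)
    = (1 + th) / 2 * E + th * (1 + th) / (1 - th) * F.
  by field; rewrite subr_eq0 !gt_eqF.
have key : E <= F + gamma * (2 * (nb_jumps v)%:R + 1) +
    ((1 + th) / 2 * E + th * (1 + th) / (1 - th) * F).
  rewrite -split_th; move: jumpterm sq_uv' noise' uv.
  rewrite mulrN -/N.
  move: (N^-1 * (_ * _ * _)) (th * (N^-1 * _)) (th * (_ + _)).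
  move: (N^-1 * (2 * \sum_i u 0 i * xi 0 i))
    (N^-1 * (2 * \sum_i v 0 i * xi 0 i)).
  move: (N^-1 * _) => *; lra.
have {}key : (1 - th) / 2 * E <=
    (1 + th ^+ 2) / (1 - th) * F + gamma * (2 * (nb_jumps v)%:R + 1).
  have -> : (1 + th ^+ 2) / (1 - th) * F = F + th * (1 + th) / (1 - th) * F.
    by field; rewrite subr_eq0 gt_eqF.
  lra.
have -> : 2 * (1 + th ^+ 2) / (1 - th) ^+ 2 * F +
    2 / (1 - th) * (gamma * (2 * (nb_jumps v)%:R + 1)) =
    ((1 - th) / 2)^-1 *
    ((1 + th ^+ 2) / (1 - th) * F + gamma * (2 * (nb_jumps v)%:R + 1)).
  by field; rewrite subr_eq0 gt_eqF.
by rewrite ler_pdivlMl// divr_gt0// subr_gt0.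
Qed.
End oracle.

(** * Step functions sampled on the grid *)

Section step_functions.
Variable R : realType.
Implicit Types (f g : R -> R).

(** The break points [t] of a representation of [g] need not be jumps, but two
    different values are separated by consecutive cells with different
    coefficients, and the point between those cells is a jump. *)
Lemma step_fun_jump_between g (x y : R) : step_fun g ->
  0 <= x -> x < y -> y < 1 -> g x != g y ->
  exists2 t, jumps g t & x < t <= y.
Proof.
move=> [m [t [al [t0 tm tS gh]]]] x0 xy y1.
pose h x := \sum_(i < m) al i * \1_`[t i, t i.+1[ x.
have {gh} -> : g = h by exact: gh.
have tle p q : (p <= q)%N -> (q <= m)%N -> t p <= t q.
  elim: q => [|q IH]; first by rewrite leqn0 => /eqP->.
  rewrite leq_eqVlt => /predU1P[->//|]; rewrite ltnS => pq qm.
  by rewrite (le_trans (IH pq (ltnW qm)))// ltW// tS.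
have hE p z : (p < m)%N -> t p <= z < t p.+1 -> h z = al p.
  move=> pm /andP[pz zp]; rewrite /h (bigD1 (Ordinal pm))//= big1 ?addr0.
    by rewrite indicE mem_set ?mulr1//= in_itv/= pz.
  move=> i /eqP ip; rewrite indicE memNset ?mulr0//= in_itv/= => /andP[iz zi].
  apply: ip; apply/val_inj => /=; apply/eqP; rewrite eqn_leq.
  apply/andP; split; rewrite leqNgt; apply/negP => ?.
    by have := tle p.+1 i _ (ltnW (ltn_ord i)); rewrite leNgt => /(_ _)/negP;
      apply => //;
      rewrite (le_lt_trans iz).
  by have := tle i.+1 p _ (ltnW pm); rewrite leNgt => /(_ _)/negP; apply => //;
      rewrite (le_lt_trans pz).
have cell z : 0 <= z -> z < 1 -> exists2 p, (p < m)%N & t p <= z < t p.+1.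
  move=> z0 z1.
  have : (m <= m)%N /\ z < t m by rewrite tm.
  move: {1 3}m; elim=> [[_]|k IH [km zk]]; first by rewrite t0 ltNge z0.
  have [kz|kz] := leP (t k) z; first by exists k; rewrite ?kz.
  by apply: IH; rewrite ltnW.
have [p pm pz] := cell _ x0 (lt_trans xy y1).
have [q qm qz] := cell _ (ltW (le_lt_trans x0 xy)) y1.
rewrite (hE p)// (hE q)// => apq.
have pq : (p < q)%N.
  rewrite ltn_neqAle; apply/andP; split; first by apply: contra_neq apq => ->.
  rewrite leqNgt; apply/negP => qp; have := tle _ _ qp (ltnW pm).
  case/andP: pz => pz _; case/andP: qz => _ qz.
  by rewrite leNgt (le_lt_trans pz)// (lt_trans xy).
have [i /andP[pi iq] ai] : exists2 i, (p <= i < q)%N & al i != al i.+1.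
  apply/not_exists2P => H; move/negP: apq; apply; apply/eqP.
  have /(_ q (ltnW pq) (leqnn _))// : forall j, (p <= j)%N -> (j <= q)%N ->
    al p = al j.
  elim=> [|j IH]; first by rewrite leqn0 => /eqP->.
  rewrite leq_eqVlt => /predU1P[->//|]; rewrite ltnS => pj jq.
  rewrite (IH pj (ltnW jq)); have [[]|/negP/negPn/eqP//] := H j.
  by rewrite pj jq.
have im : (i.+1 < m)%N by rewrite (leq_ltn_trans iq).
exists (t i.+1); last first.
  case/andP: pz => _ pz; case/andP: qz => qz _.
  by rewrite (lt_le_trans pz) ?tle ?(ltnW im)//= (le_trans _ qz)// tle// ltnW.
split.
  rewrite -t0 (le_lt_trans (tle 0%N i _ (ltnW (ltnW im)))) ?tS ?(ltnW im)//=.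
  by rewrite (le_lt_trans _ y1)//; case/andP: qz => qz _;
    rewrite (le_trans _ qz)// tle// ltnW.
have -> : lim (h z @[z --> (t i.+1)^'-]) = al i.
  apply/cvg_lim => //; apply: cvg_near_cst.
  near=> z; apply: hE; first exact: ltnW.
  apply/andP; split; near: z; last exact: nbhs_left_lt.
  by apply: nbhs_left_ge; rewrite tS// ltnW.
have -> : lim (h z @[z --> (t i.+1)^'+]) = al i.+1.
  apply/cvg_lim => //; apply: cvg_near_cst.
  near=> z; apply: hE; first by [].
  apply/andP; split; near: z; last by apply: nbhs_right_lt; rewrite tS.
  exact: nbhs_right_ge.
by [].
Unshelve. all: by end_near. Qed.

(** Disjoint sets that meet [A] contain distinct points of [A]. *)
Lemma card_disjoint_hits n k (A : set R) (B : 'I_n -> set R) :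
  (A #<= `I_k)%card ->
  (forall i j x, B i x -> B j x -> i = j) ->
  (#|[set i : 'I_n | `[< (A `&` B i) !=set0 >]]%SET| <= k)%N.
Proof.
move=> /pcard_leP[h] Binj.
have pick i : exists x : R,
  `[< (A `&` B i) !=set0 >] -> A x /\ B i x.
  have [[x [Ax Bx]]|H] := pselect ((A `&` B i) !=set0); first by exists x.
  by exists 0 => /asboolP.
pose c i := projT1 (cid (pick i)).
have cP i : `[< (A `&` B i) !=set0 >] -> A (c i) /\ B i (c i).
  exact: projT2 (cid (pick i)).
have hk x : A x -> (h x < k)%N by move=> /(@funS _ _ _ _ h).
case: k h hk => [|k] h hk.
  rewrite leqn0 cards_eq0; apply/eqP/setP => i; rewrite !inE.
  by apply/negbTE/negP => /cP[/hk].
rewrite -[leqRHS]card_ord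
  -(card_in_imset (f := fun i => inord (h (c i)) : 'I_k.+1)).
  exact: max_card.
move=> i j; rewrite !inE => /asboolP/cP[Ai Bi] /asboolP/cP[Aj Bj] /(congr1 val)
  /=.
rewrite !inordK ?hk// => /(@inj _ _ _ h); rewrite !inE => /(_ Ai Aj) ij.
by apply: (Binj _ _ (c i)) => //; rewrite ij.
Qed.

Lemma gridS_gt n i : (0 < n)%N -> grid R n i < grid R n i.+1.
Proof. by move=> n0; rewrite /grid ltr_pM2r ?invr_gt0 ?ltr0n// ltr_nat. Qed.

Lemma grid_ge0 n i : 0 <= grid R n i.
Proof. by rewrite divr_ge0. Qed.

Lemma grid_le1 n i : (i <= n)%N -> grid R n i <= 1.
Proof.
case: n => [|n]; first by rewrite /grid invr0 mulr0.
by move=> ni; rewrite ler_pdivrMr ?ltr0n// mul1r ler_nat.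
Qed.

Lemma le_grid n i j : (i <= j)%N -> grid R n i <= grid R n j.
Proof. by move=> ij; rewrite ler_wpM2r ?invr_ge0// ler_nat. Qed.

(** The cells met by a jump of [g] form the set [D]. On the other cells [g] is
    constant, and there [v] copies it; on [D] nothing relates [g] to its values
    at the design points, and [v] is set to 0 because a bounded [f] is then at
    distance [O(1 / n)] in square norm. A jump of [v] happens only next to a
    cell of [D]: this gives the factor 2. *)
Lemma discretize_step_fun g n k : (0 < n)%N -> step_fun g ->
  (jumps g #<= `I_k)%card ->
  exists (D : {set 'I_n}) (v : 'rV[R]_n),
    [/\ (#|D| <= k)%N, (nb_jumps v <= 2 * k)%N,
        forall i, i \in D -> v 0 i = 0 &
        forall i x, i \notin D -> grid R n i <= x < grid R n i.+1 ->
          g x = v 0 i].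
Proof.
move=> n0 sg jk.
(* closed on the right, so that a jump at a design point is charged to the cell
   on its left *)
pose B (i : 'I_n) := [set x : R | grid R n i < x <= grid R n i.+1].
pose D := [set i : 'I_n | `[< (jumps g `&` B i) !=set0 >]]%SET.
pose v : 'rV[R]_n := \row_i (if i \in D then 0 else g (grid R n i)).
have Dk : (#|D| <= k)%N.
  apply: card_disjoint_hits => // i j x /andP[ix xi] /andP[jx xj].
  apply/val_inj => /=; apply/eqP; rewrite eqn_leq; apply/andP; split.
    rewrite leqNgt; apply/negP => ji; have := le_grid n ji.
    by rewrite leNgt (lt_le_trans ix xj).
  rewrite leqNgt; apply/negP => ji; have := le_grid n ji.
  by rewrite leNgt (lt_le_trans jx xi).
have gE (i : 'I_n) x : i \notin D -> grid R n i <= x <= grid R n i.+1 ->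
  x < 1 ->
    g x = g (grid R n i).
  rewrite inE => /asboolPn iD /andP[ix xi] x1.
  move: ix; rewrite le_eqVlt => /predU1P[->//|ix].
  apply/eqP; apply: contraT; rewrite eq_sym => gx; case: iD.
  have [t jt /andP[it tx]] := step_fun_jump_between sg (grid_ge0 _ _) ix x1 gx.
  by exists t; split=> //; rewrite /B/= it (le_trans tx).
exists D, v; split=> //.
- apply: (@leq_trans (#|D| +
  #|[set i : 'I_n | [exists j : 'I_n, (j == i.+1 :> nat) && (j \in D)]]%SET|)).
    apply: leq_trans (leq_card_setU _ _); apply: subset_leq_card.
    apply/fintype.subsetP => i /set_mem/= /existsP[j /andP[/eqP ji]];
      rewrite !mxE => vij.
    rewrite finset.in_setU; have [//|iD] := boolP (i \in D); rewrite orFb.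
    rewrite inE; apply/existsP; exists j; rewrite ji eqxx/=.
    apply: contraT => jD; move: vij; rewrite (negbTE iD) (negbTE jD).
    rewrite (gE i (grid R n j)) ?eqxx// ji.
      by rewrite lexx andbT le_grid.
    by rewrite -ji ltr_pdivrMr ?ltr0n// mul1r ltr_nat.
  rewrite mul2n -addnn leq_add//.
  apply: leq_trans Dk.
  have [->|[i0 _]] := set_0Vmem D.
    rewrite cards0 leqn0 cards_eq0; apply/eqP/setP => i; rewrite !inE.
    by apply/negbTE/existsPn => j; rewrite inE andbF.
  pose nxt (i : 'I_n) : 'I_n := insubd i0 i.+1.
  rewrite -(card_in_imset (f := nxt)).
    apply: subset_leq_card; apply/fintype.subsetP => _ /imsetP[i + ->].
    rewrite inE => /existsP[j /andP[/eqP ji jD]].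
    by rewrite (_ : nxt i = j)//; apply/val_inj; rewrite val_insubd -ji ltn_ord.
  move=> i i'; rewrite !inE => /existsP[j /andP[/eqP ji _]]
    /existsP[j' /andP[/eqP ji' _]].
  move=> /(congr1 val); rewrite !val_insubd -ji -ji' !ltn_ord ji ji' => -[].
  exact: val_inj.
- by move=> i iD; rewrite mxE iD.
- move=> i x iD /andP[ix xi]; rewrite mxE (negbTE iD); apply: gE => //.
    by rewrite ix ltW.
  by rewrite (lt_le_trans xi)// grid_le1.
Qed.
End step_functions.

(** * L2 distances of grid functions to the target *)

Section embedding.
Variable R : realType.
Local Notation mu := (@lebesgue_measure R).
Local Notation I01 := (`[0, 1[%classic : set R).
Implicit Types (f g h : R -> R) (A : set R).

(** The square of [L2norm] ([L2norm_le]); unlike the norm it is additive over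
    cells. *)
Definition sqnorm h : \bar R := (\int[mu]_(x in `[0%R, 1%R[) ((h x) ^+ 2)%:E)%E.

Lemma L2norm_le h (c : R) : 0 <= c ->
  (L2norm h <= c%:E)%E = (sqnorm h <= (c ^+ 2)%:E)%E.
Proof.
move=> c0.
have -> : sqnorm h = (L2norm h `^ 2)%E.
  rewrite /L2norm poweR_Lnorm// /sqnorm [LHS]integral_mkcond.
  apply: eq_integral => x _ /=; rewrite patchE/= /patch.
  case: ifPn => _ /=; last by rewrite normr0 powR0.
  by rewrite powR_mulrn// real_normK ?num_real.
have -> : ((c ^+ 2)%:E = c%:E `^ 2)%E by rewrite poweR_EFin powR_mulrn.
have N0 : (0 <= L2norm h)%E by exact: Lnorm_ge0.
have mono (x y : \bar R) (r : R) : 0 <= r -> (0 <= x -> 0 <= y -> x <= y ->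
    x `^ r <= y `^ r)%E.
  by move=> r0 x0 y0 xy; apply: gt0_ler_poweR => //;
    rewrite in_itv/= leey andbT.
apply/idP/idP => H; first by apply: mono; rewrite ?lee_fin.
have := mono _ _ 2^-1 _ (poweR_ge0 _ _) (poweR_ge0 _ _) H.
by rewrite -!poweRrM divff// !poweRe1// ?lee_fin//; apply; rewrite invr_ge0.
Qed.

Lemma ae_boundedS d (T : measurableType d) (nu : {measure set T -> \bar R})
    (A B : set T) (f : T -> R) (M : R) : B `<=` A ->
  {ae nu, forall x, A x -> `|f x| <= M} ->
    {ae nu, forall x, B x -> `|f x| <= M}.
Proof. by move=> BA; apply: filterS => x fM /BA. Qed.

Lemma Linfty01_bounded f : Linfty01 f ->
  measurable_fun I01 f /\ exists2 M,
    0 <= M & {ae mu, forall x, I01 x -> `|f x| <= M}.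
Proof.
rewrite /Linfty01 => /andP[/set_mem/= mf /set_mem/=].
rewrite /finite_norm unlock /= => fM.
split.
  have /(measurable_funS measurableT (@subsetT _ I01)) := mf.
  by apply: eq_measurable_fun => x; rewrite inE => x01; rewrite patchE mem_set.
have [|M HM] := @ess_supr_bounded _ _ _ mu (Num.norm \o (f \_ `[0, 1[)) _.
  move: fM; rewrite ifT//.
  by rewrite -set_itvNyy lebesgue_measure_itv/= ltry.
exists `|M| => //; apply: filterS HM => x /= xM x01.
rewrite patchE mem_set// in xM; exact: le_trans xM (ler_norm _).
Qed.

Section cell.
Context d (T : measurableType d) (nu : {measure set T -> \bar R}).
Variables (A : set T) (f : T -> R) (m M : R).
Hypotheses (mA : measurable A) (nuA : nu A = m%:E) (m0 : 0 < m) (M0 : 0 <= M).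
Hypotheses (mf : measurable_fun A f)
  (fM : {ae nu, forall x, A x -> `|f x| <= M}).

Lemma ae_bounded_integrable : nu.-integrable A (EFin \o f).
Proof.
apply/integrableP; split; first exact/measurable_EFinP.
apply: (@le_lt_trans _ _ (M%:E * nu A)%E); last by rewrite nuA ltry.
apply: integral_le_bound => //; first exact/measurable_EFinP.
Qed.

Let ae_sqr_le : {ae nu, forall x, A x -> (f x ^+ 2 <= M ^+ 2)}.
Proof.
apply: filterS fM => x + Ax => /(_ Ax) fxM.
by rewrite -real_normK ?num_real// lerXn2r ?nnegrE.
Qed.

Lemma integral_sqr_le : (\int[nu]_(x in A) (f x ^+ 2)%:E <= (M ^+ 2 * m)%:E)%E.
Proof.
rewrite EFinM -nuA -integral_cst//; apply: ae_ge0_le_integral => //.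
- by move=> x _; rewrite lee_fin sqr_ge0.
- by apply/measurable_EFinP; exact: measurable_funX.
- by move=> x _; rewrite lee_fin sqr_ge0.
Qed.

Let integrable_f2 : nu.-integrable A (EFin \o (fun x => f x ^+ 2)).
Proof.
apply/integrableP; split.
  by apply/measurable_EFinP; exact: measurable_funX.
under eq_integral do rewrite /= ger0_norm ?sqr_ge0//.
by apply: le_lt_trans integral_sqr_le _; rewrite ltry.
Qed.

(** Bias-variance decomposition: the mean of [f] is its projection on the
    constants, and [s] is the integral of the squared deviation from it. *)
Lemma integral_sqr_dist_mean : exists2 s, 0 <= s & forall c : R,
  (\int[nu]_(x in A) ((c - f x) ^+ 2)%:E =
   (m * (c - m^-1 * \int[nu]_(x in A) f x) ^+ 2 + s)%:E)%E.
Proof.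
have intf := ae_bounded_integrable.
pose F := (\int[nu]_(x in A) f x)%R.
pose Q := (\int[nu]_(x in A) (f x ^+ 2))%R.
have int_cst c : nu.-integrable A (EFin \o cst c).
  apply/integrableP; split; first exact/measurable_EFinP.
  by rewrite /= integral_cst// nuA -EFinM ltry.
have H c : (\int[nu]_(x in A) ((c - f x) ^+ 2)%:E =
   (m * (c - m^-1 * F) ^+ 2 + (Q - m^-1 * F ^+ 2))%:E)%E.
  transitivity (\int[nu]_(x in A)
    ((c ^+ 2)%:E + ((- 2 * c)%:E * (f x)%:E + (f x ^+ 2)%:E)))%E.
    by apply: eq_integral => x _; rewrite -EFinM -!EFinD; congr EFin; ring.
  rewrite integralD//; last 2 first.
  - exact: int_cst.
  - apply: integrableD => //; exact: integrableZl.
  rewrite integralD//; last exact: integrableZl.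
  rewrite integralZl// integral_cst// nuA.
  rewrite -[X in (_ + (_ * X + _))%E]fineK; last exact: integrable_fin_num.
  rewrite -[X in (_ + (_ + X))%E]fineK;
    last exact: (integrable_fin_num _ integrable_f2).
  rewrite -!EFinM -!EFinD -/(Rintegral nu A f) -/F.
  rewrite -/(Rintegral nu A (fun x => f x ^+ 2)) -/Q.
  by congr EFin; field; rewrite gt_eqF.
exists (Q - m^-1 * F ^+ 2) => //.
rewrite -lee_fin.
have := H (m^-1 * F); rewrite subrr expr0n/= mulr0 add0r => <-.
by apply: integral_ge0 => x _; rewrite lee_fin sqr_ge0.
Qed.

End cell.

Definition cell n i : set R := `[grid R n i, grid R n i.+1[%classic.

Lemma cell_sub n (i : 'I_n) : cell n i `<=` `[0, 1[.
Proof.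
move=> x; rewrite /cell/= !in_itv/= => /andP[ix xi].
by rewrite (le_trans (grid_ge0 _ _ _) ix) (lt_le_trans xi)// grid_le1.
Qed.

Lemma measure_cell n i : (0 < n)%N -> mu (cell n i) = (n%:R^-1)%:E.
Proof.
move=> n0; rewrite /cell lebesgue_measure_itv/= lte_fin gridS_gt//.
by rewrite -EFinD /grid -mulrBl -natr1 addrAC subrr add0r mul1r.
Qed.

Lemma in_cell_unique n i j x : cell n i x -> cell n j x -> i = j.
Proof.
have le a b : cell n a x -> cell n b x -> (b <= a)%N.
  rewrite /cell/= !in_itv/= => /andP[ax xa] /andP[bx xb].
  rewrite leqNgt; apply/negP => ab; have := le_grid R n ab.
  by rewrite leNgt (le_lt_trans bx xa).
by move=> ix jx; apply/eqP; rewrite eqn_leq !le.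
Qed.

Lemma bigcup_cells n : (0 < n)%N ->
  \big[setU/set0]_(i < n) cell n i = `[0, 1[%classic.
Proof.
move=> n0; rewrite -bigcup_mkord; apply/seteqP; split=> x.
  by case=> i ilt; exact: (@cell_sub n (Ordinal ilt)).
rewrite /= in_itv/= => /andP[x0 x1].
have nx0 : 0 <= n%:R * x by rewrite mulr_ge0.
have /andP[kx xk] := truncn_itv nx0.
have kn : (Num.truncn (n%:R * x) < n)%N.
  rewrite -(ltr_nat R); apply: le_lt_trans kx _.
  by rewrite -[ltRHS]mulr1 ltr_pM2l// ltr0n.
exists (Num.truncn (n%:R * x)) => //=; rewrite /cell/= in_itv/=.
by rewrite ler_pdivrMr ?ltr_pdivlMr ?ltr0n// (mulrC x) kx.
Qed.

Lemma integral_cells n (h : R -> \bar R) : (0 < n)%N ->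
  measurable_fun I01 h -> (forall x, (0 <= h x)%E) ->
  (\int[mu]_(x in `[0%R, 1%R[) h x =
    \sum_(i < n) \int[mu]_(x in cell n i) h x)%E.
Proof.
move=> n0 mh h0; rewrite -(bigcup_cells n0).
apply: (@ge0_integral_bigsetU _ _ _ mu _ (fun i : 'I_n => cell n i)) => //.
- by move=> i; exact: measurable_itv.
- exact: index_enum_uniq.
- by move=> i j _ _ [x [ix jx]]; apply/val_inj; exact: (in_cell_unique ix jx).
- by rewrite bigcup_cells.
Qed.

Lemma embed_cell n (u : 'rV[R]_n) (i : 'I_n) x : cell n i x ->
  embed u x = u 0 i.
Proof.
move=> ix; rewrite /embed (bigD1 i)//= big1 ?addr0.
  by rewrite indicE mem_set ?mulr1.
move=> j /eqP ji; rewrite indicE memNset ?mulr0// => jx.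
by apply: ji; apply/val_inj; exact: (in_cell_unique jx ix).
Qed.

Definition cell_means f n : 'rV[R]_n := \row_i cell_mean f i.

Lemma sqnorm_cells h n : (0 < n)%N -> measurable_fun I01 h ->
  sqnorm h = (\sum_(i < n) \int[mu]_(x in cell n i) (h x ^+ 2)%:E)%E.
Proof.
move=> n0 mh; apply: integral_cells => //.
  by apply/measurable_EFinP; exact: measurable_funX.
by move=> x; rewrite lee_fin sqr_ge0.
Qed.

Lemma measurable_embed n (u : 'rV[R]_n) D : measurable_fun D (embed u).
Proof.
apply: measurable_sum => i; apply: measurable_funM => //.
Qed.

Lemma sqnorm_embedB n f u : (0 < n)%N -> measurable_fun I01 f ->
  sqnorm (embed u \- f) =
  (\sum_(i < n) \int[mu]_(x in cell n i) ((u 0 i - f x) ^+ 2)%:E)%E.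
Proof.
move=> n0 mf; rewrite (sqnorm_cells n0); last first.
  by apply: measurable_funB => //; exact: measurable_embed.
apply: eq_bigr => i _; apply: eq_integral => x; rewrite inE => ix /=.
by rewrite (embed_cell _ ix).
Qed.

(** Pythagoras for the projection of [f] on the functions constant on cells.
    The remainder [c] is the discretisation error; as it is the same for all
    [u], an inequality between values of [sqdist] turns into one between L2
    distances to [f]. *)
Lemma sqnorm_embed_decomposition n f : (0 < n)%N -> Linfty01 f ->
  exists2 c, 0 <= c &
    forall u : 'rV[R]_n, sqnorm (embed u \- f) =
      (sqdist u (cell_means f n) + c)%:E.
Proof.
move=> n0 /Linfty01_bounded[mf [M M0 fM]].
have invn0 : 0 < n%:R^-1 :> R by rewrite invr_gt0 ltr0n.
have mfi (i : 'I_n) : measurable_fun (cell n i) f.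
  by apply: measurable_funS mf => //; exact: cell_sub.
have fMi (i : 'I_n) := @ae_boundedS _ _ mu I01 (cell n i) f M (@cell_sub n i)
  fM.
have mean (i : 'I_n) := @integral_sqr_dist_mean _ _ mu (cell n i) f n%:R^-1 M
  (measurable_itv _) (measure_cell i n0) invn0 M0 (mfi i) (fMi i).
pose s i := s2val (cid2 (mean i)).
have s0 i : 0 <= s i := s2valP (cid2 (mean i)).
have sE i := s2valP' (cid2 (mean i)).
exists (\sum_i s i) => [|u]; first by rewrite sumr_ge0.
rewrite sqnorm_embedB// /sqdist mulr_sumr -big_split/= -sumEFin.
apply: eq_bigr => i _; rewrite sE; congr (_ * (_ - _) ^+ 2 + _)%:E.
rewrite mxE /cell_mean; congr (_ * _).
  by rewrite /grid -mulrBl -natr1 addrAC subrr add0r mul1r.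
rewrite /cell Rintegral_itv_bndo_bndc//.
exact: (@ae_bounded_integrable _ _ mu (cell n i) f n%:R^-1 M (measurable_itv _)
  (measure_cell i n0) M0 (mfi i) (fMi i)).
Qed.

(** Only the at most [k] cells met by a jump of [g] contribute more than their
    share of [sqnorm (g \- f)]. *)
Lemma discretize_approx f : Linfty01 f -> exists2 M, 0 <= M &
  forall g n k, (0 < n)%N -> step_fun g -> (jumps g #<= `I_k)%card ->
  exists2 v : 'rV[R]_n, (nb_jumps v <= 2 * k)%N &
    (sqnorm (embed v \- f)%R <= sqnorm (g \- f)%R + (M * (k%:R / n%:R))%:E)%E.
Proof.
move=> /Linfty01_bounded[mf [M M0 fM]]; exists (M ^+ 2); first exact: sqr_ge0.
move=> g n k n0 sg jg.
have [D [v [Dk vk vD vND]]] := discretize_step_fun n0 sg jg.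
exists v => //.
have invn0 : 0 < n%:R^-1 :> R by rewrite invr_gt0 ltr0n.
have mg : measurable_fun I01 g.
  case: sg => m [t [al [_ _ _ ->]]].
  by apply: measurable_sum => i; apply: measurable_funM.
rewrite sqnorm_embedB// (sqnorm_cells n0); last exact: measurable_funB.
apply: (@le_trans _ _ (\sum_(i < n)
  (\int[mu]_(x in cell n i) ((g x - f x) ^+ 2)%:E
   + ((i \in D)%:R * (M ^+ 2 / n%:R))%:E))%E); last first.
  rewrite big_split/=; apply: leeD => //.
  rewrite sumEFin lee_fin -mulr_suml -natr_sum.
  have -> : (\sum_(i < n) (i \in D) = #|D|)%N.
    by rewrite -sum1_card [RHS]big_mkcond; apply: eq_bigr => i _;
      case: (_ \in _).
  by rewrite mulrCA ler_wpM2l ?sqr_ge0// ler_wpM2r ?(ltW invn0)// ler_nat.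
apply: lee_sum => i _; have [iD|iD] := boolP (i \in D).
  rewrite vD// mul1r; under eq_integral do rewrite sub0r sqrrN.
  apply: (@le_trans _ _ ((M ^+ 2 / n%:R)%:E)).
    apply: (@integral_sqr_le _ _ mu (cell n i) f n%:R^-1 M (measurable_itv _)
      (measure_cell i n0)) => //.
    - by apply: measurable_funS mf => //; exact: cell_sub.
    - exact: @ae_boundedS _ _ mu I01 (cell n i) f M (@cell_sub n i) fM.
  by rewrite leeDr// integral_ge0// => x _; rewrite lee_fin sqr_ge0.
rewrite mul0r adde0; under [leRHS]eq_integral => x.
  rewrite inE /cell/= in_itv/= => ix; rewrite (vND i x iD ix); over.
by [].
Qed.
End embedding.

(** * Expectations of products of independent variables *)

Section independence.
Context d (Omega : measurableType d) (R : realType) (P : probability Omega R).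
Import HBNNSimple.

(** The hypothesis [law] says that, for a weight [W], the law of [X] under the
    measure of density [W] is [c] times its law under [P]. Integrals of
    functions of [X] then obey the same rule, by approximation with simple
    functions. *)
Section weighted_law.
Variables (X : {RV P >-> R}) (W : Omega -> R) (c : R).
Hypotheses (mW : measurable_fun setT W) (W0 : forall w, 0 <= W w).
Hypothesis law : forall B : set R, measurable B ->
  (\int[P]_w (W w * \1_B (X w))%:E = c%:E * P (X @^-1` B))%E.

Lemma integral_weighted_nnsfun (h : {nnsfun R >-> R}) :
  (\int[P]_w (W w * h (X w))%:E =
   c%:E * \sum_(r \in range h) r%:E * P (X @^-1` (h @^-1` [set r])))%E.
Proof.
have mX (B : set R) : measurable B -> measurable (X @^-1` B).
  by move=> mB; rewrite -[_ @^-1` _]setTI; exact: measurable_funP.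
transitivity (\sum_(r \in range h)
    (\int[P]_w (r%:E * (W w * \1_(h @^-1` [set r]) (X w))%:E)))%E.
  rewrite -ge0_integral_fsum//.
  - apply: eq_integral => w _; rewrite fimfunE mulr_fsumr -fsumEFin//.
    by apply: eq_fsbigr => r _; rewrite -EFinM mulrCA.
  - move=> r; apply: measurable_funeM; apply/measurable_EFinP.
    apply: measurable_funM => //; apply: measurableT_comp => //.
  - move=> r w _; have := nnfun_muleindic_ge0 h r (X w).
    by rewrite !lee_fin mulrCA => ?; rewrite mulr_ge0.
rewrite ge0_mule_fsumr; last first.
  move=> r; have [[x _ <-]|rN] := pselect (range h r).
    by rewrite mule_ge0// lee_fin.
  rewrite preimage10// preimage_set0 measure0 mule0//.
apply: eq_fsbigr => r; rewrite inE => -[x _ <-].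
rewrite ge0_integralZl_EFin//.
- by rewrite law// muleCA.
- by move=> w _; rewrite lee_fin mulr_ge0.
- apply/measurable_EFinP; apply: measurable_funM => //.
  by apply: measurableT_comp => //.
Qed.

Lemma cvg_integral_weighted (g : R -> R)
  (mg : measurable_fun setT (EFin \o g)) :
  (forall x, 0 <= g x) ->
  (\int[P]_w (W w * nnsfun_approx measurableT mg n (X w))%:E @[n --> \oo] -->
   \int[P]_w (W w * g (X w))%:E)%E.
Proof.
move=> g0.
have -> : (\int[P]_w (W w * g (X w))%:E = \int[P]_w
   (limn (fun n => (W w * nnsfun_approx measurableT mg n (X w))%:E)))%E.
  apply: eq_integral => w _; apply/esym/cvg_lim => //.
  under eq_fun do rewrite EFinM; rewrite EFinM; apply: cvgeZl => //.
  by apply: cvg_nnsfun_approx => // x _; rewrite lee_fin.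
apply: cvg_monotone_convergence => //.
- move=> n; apply/measurable_EFinP; apply: measurable_funM => //.
  by apply: measurableT_comp.
- by move=> n w _; rewrite lee_fin mulr_ge0.
- move=> w _ m n mn; rewrite lee_fin ler_wpM2l//.
  by apply/lefP/nd_nnsfun_approx.
Qed.

End weighted_law.

Lemma integral_weighted_comp (X : {RV P >-> R}) (W : Omega -> R) (c : R) :
  measurable_fun setT W -> (forall w, 0 <= W w) ->
  (forall B : set R, measurable B ->
    (\int[P]_w (W w * \1_B (X w))%:E = c%:E * P (X @^-1` B))%E) ->
  forall g : R -> R, measurable_fun setT g -> (forall x, 0 <= g x) ->
  (\int[P]_w (W w * g (X w))%:E = c%:E * \int[P]_w (g (X w))%:E)%E.
Proof.
move=> mW W0 law g /measurable_EFinP mg g0.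
have mX (B : set R) : measurable B -> measurable (X @^-1` B).
  by move=> mB; rewrite -[_ @^-1` _]setTI; exact: measurable_funP.
have law1 (B : set R) : measurable B ->
    (\int[P]_w (cst 1 w * \1_B (X w))%:E = 1%:E * P (X @^-1` B))%E.
  move=> mB; transitivity (\int[P]_w (\1_(X @^-1` B) w)%:E)%E.
    by apply: eq_integral => w _; rewrite mul1r.
  by rewrite mul1e integral_indic ?setIT//; exact: mX.
have cv := @cvg_integral_weighted X _ mW W0 _ mg g0.
have mcst : measurable_fun setT (cst 1 : Omega -> R) by exact: measurable_cst.
have cv1 := @cvg_integral_weighted X _ mcst (fun=> ler01) _ mg g0.
have -> : (\int[P]_w (g (X w))%:E = \int[P]_w (cst 1 w * g (X w))%:E)%E.
  by apply: eq_integral => w _; rewrite mul1r.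
have WE (h : {nnsfun R >-> R}) :
    (\int[P]_w (W w * h (X w))%:E = c%:E * \int[P]_w (cst 1 w * h (X w))%:E)%E.
  rewrite (integral_weighted_nnsfun mW W0 law).
  by rewrite (integral_weighted_nnsfun mcst (fun=> ler01) law1) mul1e.
apply: (cvg_unique _ cv) => //.
have WEn n := WE (nnsfun_approx measurableT mg n).
rewrite /= (eq_cvg _ _ WEn).
exact: cvgeZl.
Qed.

(** Independence is the product rule for events. The indicators are traded for
    the functions [g i] one variable at a time: the factors that are already
    functions and the remaining indicators together form a weight under which
    the next variable keeps its law up to a constant. *)
Lemma indep_integral_prod (I : finType) (X : I -> {RV P >-> R})
    (g : I -> R -> R) (m : I -> R) : indep_RVs X ->
  (forall i, measurable_fun setT (g i)) -> (forall i x, 0 <= g i x) ->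
  (forall i, \int[P]_w (g i (X i w))%:E = (m i)%:E)%E ->
  (\int[P]_w (\prod_i g i (X i w))%:E = (\prod_i m i)%:E)%E.
Proof.
move=> indepX mg g0 gm.
have mX i (B : set R) : measurable B -> measurable (X i @^-1` B).
  by move=> mB; rewrite -[_ @^-1` _]setTI; exact: measurable_funP.
pose p i (B : set R) := fine (P (X i @^-1` B)).
have pE i B : measurable B -> P (X i @^-1` B) = (p i B)%:E.
  by move=> mB; rewrite fineK// fin_num_measure//; exact: mX.
(* functions on [s], indicators on [J] *)
suff gen (s : seq I) (J : {set I}) (B : I -> set R) :
    uniq s -> (forall i, i \in s -> i \notin J) ->
    (forall i, measurable (B i)) ->
    (\int[P]_w (\prod_(i <- s) g i (X i w) * \prod_(j in J) \1_(B j) (X j w))%:E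
      =
     (\prod_(i <- s) m i * \prod_(j in J) p j (B j))%:E)%E.
  have := gen (index_enum I) finset.set0 (fun=> setT) (index_enum_uniq _) _ _.
  under eq_integral do rewrite [X in _ * X]big_set0 mulr1.
  by rewrite [X in _ * X]big_set0 mulr1; apply => // i _;
    rewrite finset.in_set0.
elim: s J B => [|i s IH] J B.
  move=> _ _ mB; under eq_integral do rewrite big_nil mul1r.
  rewrite big_nil mul1r.
  have := indepX J B mB.
  have -> : (\prod_(i in J) P (X i @^-1` B i) =
    (\prod_(j in J) p j (B j))%:E)%E.
    rewrite -prodEFin; apply: eq_bigr => i _; exact: pE.
  move=> <-.
  have mJ : measurable (\bigcap_(i in [set` J]) X i @^-1` B i).
    by apply: fin_bigcap_measurable => // i _; exact: mX.
  transitivity (\int[P]_w (\1_(\bigcap_(i in [set` J]) X i @^-1` B i) w)%:E)%E;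
    last by rewrite integral_indic ?setIT.
  apply: eq_integral => w _; congr EFin; rewrite indicE.
  case: (boolP (w \in _)) => [/set_mem wJ|/negP wJ].
    by rewrite big1// => j jJ; rewrite indicE mem_set//; exact: wJ.
  have [j jJ wj] : exists2 j, j \in J & ~ B j (X j w).
    apply: contrapT => H; apply: wJ; rewrite inE => j /= jJ.
    by apply: contrapT => jB; apply: H; exists j.
  by rewrite (bigD1 j)//= indicE memNset// mul0r.
move=> /= /andP[iNs us] sJ mB.
have iNJ : i \notin J by apply: sJ; rewrite mem_head.
under eq_integral do rewrite big_cons -mulrA mulrC.
rewrite (integral_weighted_comp (X := X i)
  (W := fun w => \prod_(j <- s) g j (X j w) * \prod_(j in J) \1_(B j) (X j w))
  (c := \prod_(j <- s) m j * \prod_(j in J) p j (B j))).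
- by rewrite gm -EFinM big_cons mulrC mulrA.
- apply: measurable_funM.
    by apply: measurable_prod => j _; apply: measurableT_comp.
  rewrite [X in measurable_fun _ X](_ : _ = fun w =>
    \prod_(j <- enum J) \1_(B j) (X j w)); last by apply/funext => w;
      rewrite big_enum.
  apply: measurable_prod => j _; apply: measurableT_comp => //.
- move=> w; rewrite mulr_ge0// ?prodr_ge0//.
- move=> B0 mB0.
  pose B' j := if j == i then B0 else B j.
  transitivity (\int[P]_w (\prod_(j <- s) g j (X j w) *
      \prod_(j in (i |: J)%SET) \1_(B' j) (X j w))%:E)%E.
    apply: eq_integral => w _; congr EFin; rewrite -mulrA; congr (_ * _).
    rewrite big_setU1//= mulrC /B' eqxx; congr (_ * _).
    apply: eq_bigr => j jJ; rewrite ifN//.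
    by apply: contraNneq iNJ => <-.
  rewrite IH//; last 2 first.
  - move=> j js; rewrite finset.in_setU1 negb_or; apply/andP; split.
      by apply: contraNneq iNs => <-.
    by apply: sJ; rewrite in_cons js orbT.
  - by move=> j; rewrite /B'; case: ifP.
  rewrite pE// -EFinM big_setU1//= /B' eqxx; congr EFin.
  rewrite mulrCA [LHS]mulrC; congr (_ * _ * _).
  apply: eq_bigr => j jJ; rewrite ifN//.
  by apply: contraNneq iNJ => <-.
- exact: mg.
- exact: g0.
Qed.

End independence.

(** * Subgaussian tails and a convergent series *)

Section concentration.
Context d (Omega : measurableType d) (R : realType) (P : probability Omega R).

Lemma mgf_sum_le (I : finType) (X : I -> {RV P >-> R}) (beta nu : R)
  (A : {set I}) :
  indep_RVs X -> (forall i, 'M_P (X i) nu <= (expR (beta * nu ^+ 2))%:E)%E ->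
  ('M_P (fun w => (\sum_(i in A) X i w)%R) nu <=
     (expR (#|A|%:R * (beta * nu ^+ 2)))%:E)%E.
Proof.
move=> indepX mgf.
have mfin i : 'M_P (X i) nu = (fine ('M_P (X i) nu))%:E.
  rewrite fineK// ge0_fin_numE; first exact: le_lt_trans (mgf i) (ltry _).
  by rewrite /mmt_gen_fun unlock; apply: integral_ge0 => w _;
    rewrite lee_fin expR_ge0.
pose g i (x : R) := if i \in A then expR (x * nu) else 1.
pose m i := if i \in A then fine ('M_P (X i) nu) else 1.
have := @indep_integral_prod _ _ _ P I X g m indepX.
have -> : 'M_P (fun w => \sum_(i in A) X i w) nu =
  (\int[P]_w (\prod_i g i (X i w))%:E)%E.
  rewrite /mmt_gen_fun unlock; apply: eq_integral => w _; congr EFin => /=.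
  by rewrite mulr_suml expR_sum [LHS]big_mkcond.
move=> ->.
- rewrite lee_fin expRM_natl -prodr_const /m -big_mkcond/=;
  apply: ler_prod => i _; rewrite -!lee_fin -mfin mgf andbT.
  by rewrite /mmt_gen_fun unlock; apply: integral_ge0 => w _;
    rewrite lee_fin expR_ge0.
- move=> i; rewrite /g; case: (i \in A) => //.
  by apply: measurableT_comp => //; exact: mulrr_measurable.
- by move=> i x; rewrite /g; case: (i \in A); rewrite ?expR_ge0.
- move=> i; rewrite /g /m; case: (i \in A).
    by rewrite -mfin /mmt_gen_fun unlock.
  by rewrite integral_cst// mul1e; exact: probability_setT.
Qed.

Lemma chernoff_fun (S : Omega -> R) (r a : R) : measurable_fun setT S ->
  0 < r -> (P [set w | a <= S w]%R <= 'M_P S r * (expR (- (r * a)))%:E)%E.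
Proof.
move=> mS; pose S_mixin := isMeasurableFun.Build _ _ _ _ _ mS.
pose S_RV : {mfun Omega >-> R} := HB.pack S S_mixin.
exact: (@chernoff _ _ _ P S_RV r a).
Qed.

Lemma measurable_sum_in (I : finType) (X : I -> {RV P >-> R}) (A : {set I}) :
  measurable_fun setT (fun w => \sum_(i in A) X i w).
Proof.
under eq_fun do rewrite -big_enum/=.
by apply: measurable_sum => i.
Qed.

Lemma measurable_tail (I : finType) (X : I -> {RV P >-> R}) (A : {set I})
  (a : R) :
  measurable [set w | a < (\sum_(i in A) X i w) ^+ 2]%R.
Proof.
rewrite -[X in measurable X]setTI; under eq_set do rewrite -lte_fin.
apply: measurable_lte => //; apply/measurable_EFinP.
by apply: measurable_funX; exact: measurable_sum_in.
Qed.

(** Chernoff's bound for the sum and its opposite. The exponent [r] minimises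
    [m * beta * r ^ 2 - r * s], for the deviation [s] = sqrt([m * T]) of a sum
    of [m] variables. *)
Lemma subgaussian_tail (I : finType) (X : I -> {RV P >-> R}) (beta T : R)
    (A : {set I}) : indep_RVs X -> 0 < beta ->
  (forall i nu, 'M_P (X i) nu <= (expR (beta * nu ^+ 2))%:E)%E ->
  (0 < #|A|)%N -> 0 <= T ->
  (P [set w | #|A|%:R * T < (\sum_(i in A) X i w) ^+ 2]%R <=
   (2 * expR (- (T / (4 * beta))))%:E)%E.
Proof.
move=> indepX b0 mgf A0; rewrite le_eqVlt => /predU1P[<-|T0].
  rewrite mul0r oppr0 expR0 mulr1 (le_trans (probability_le1 _ _))//.
    by apply: measurable_tail.
  by rewrite lee_fin ler1n.
pose m : R := #|A|%:R; have m0 : 0 < m by rewrite ltr0n.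
pose s := Num.sqrt (m * T); have s0 : 0 < s by rewrite sqrtr_gt0 mulr_gt0.
have s2 : s ^+ 2 = m * T by rewrite sqr_sqrtr// ltW// mulr_gt0.
pose r := s / (2 * beta * m).
have r0 : 0 < r by rewrite divr_gt0// !mulr_gt0.
pose S w := \sum_(i in A) X i w.
have one_sided (S' : Omega -> R) : measurable_fun setT S' ->
    ('M_P S' r <= (expR (m * (beta * r ^+ 2)))%:E)%E ->
    (P [set w | s <= S' w]%R <= (expR (- (T / (4 * beta))))%:E)%E.
  move=> mS' mgfS'; apply: (le_trans (chernoff_fun _ mS' r0)).
  apply: le_trans (lee_wpmul2r _ mgfS') _; first by rewrite lee_fin expR_ge0.
  rewrite -EFinM -expRD lee_fin ler_expR.
  have -> : m * (beta * r ^+ 2) - r * s = - (s ^+ 2 / m / (4 * beta)).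
    by rewrite /r; field; rewrite !gt_eqF.
  by rewrite s2 (mulrC m) mulfK ?gt_eqF.
have mS : measurable_fun setT S by exact: measurable_sum_in.
have mgfS : ('M_P S r <= (expR (m * (beta * r ^+ 2)))%:E)%E
  by exact: mgf_sum_le.
have mgfNS : ('M_P (\- S)%R r <= (expR (m * (beta * r ^+ 2)))%:E)%E.
  rewrite -(sqrrN r) [leLHS](_ : _ = 'M_P S (- r)).
    exact: mgf_sum_le.
  by rewrite /mmt_gen_fun; congr ('E_P[_])%E; apply/funext => w /=;
    rewrite mulNr mulrN.
have mNS : measurable_fun setT (\- S) by exact: measurableT_comp.
apply: (@le_trans _ _ (P ([set w | s <= S w] `|` [set w | s <= (\- S) w])%R)).
  apply: le_measure; rewrite ?inE.
  - exact: measurable_tail.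
  - by apply: measurableU; rewrite -[X in measurable X]setTI;
      exact: measurable_fun_le.
  move=> w /=; rewrite -/m -/(S w) -s2 => sS.
  have : s < `|S w| by rewrite -(ltr_pXn2r (n := 2))// ?nnegrE ?(ltW s0)//
    real_normK ?num_real.
  by rewrite ltr_normr => /orP[/ltW|/ltW]; [left|right].
apply: le_trans (measureU2 _ _ _) _.
- by rewrite -[X in measurable X]setTI; exact: measurable_fun_le.
- by rewrite -[X in measurable X]setTI; exact: measurable_fun_le.
rewrite mulrDl mul1r EFinD leeD//; exact: one_sided.
Qed.

End concentration.

Section Riemann.
Variable R : realType.

(** From ln (1 + x) <= x at x = - 1 / (n + 2); it bounds the terms of the
    series of [n ^ - (1 + e)] by those of a telescoping series. *)
Lemma powR_telescope (e : R) n : 0 < e ->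
  e * n.+2%:R `^ (- (1 + e)) <= n.+1%:R `^ (- e) - n.+2%:R `^ (- e).
Proof.
move=> e0; rewrite lerBrDr.
have n2 : 0 < n.+2%:R :> R by rewrite ltr0n.
have n1 : 0 < n.+1%:R :> R by rewrite ltr0n.
have -> : n.+2%:R `^ (- (1 + e)) = n.+2%:R `^ (- e) / n.+2%:R :> R.
  by rewrite opprD addrC powRD ?powR_inv1// ?(ltW n2)// (gt_eqF n2) implybT.
have -> : n.+1%:R `^ (- e) =
  n.+2%:R `^ (- e) * (n.+1%:R / n.+2%:R) `^ (- e) :> R.
  rewrite -powRM ?divr_ge0//; congr (_ `^ _); field; rewrite gt_eqF//.
rewrite [leLHS](_ : _ = n.+2%:R `^ (- e) * (1 + e / n.+2%:R)); last by ring.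
rewrite ler_wpM2l ?powR_ge0// /powR gt_eqF ?divr_gt0//.
apply: le_trans (expR_ge1Dx _) _; rewrite ler_expR mulNr -mulrN ler_pM2l//.
rewrite lerNr.
have -> : n.+1%:R / n.+2%:R = 1 + - n.+2%:R^-1 :> R.
  by rewrite -{1}(addrK 1 n.+1%:R) natr1 mulrBl divff ?gt_eqF// mul1r.
by apply: le_ln1Dx; rewrite ltrN2 invf_lt1// ltr1n.
Qed.

Lemma powR_series_lty (e : R) : 0 < e ->
  (\sum_(n <oo) (n%:R `^ (- (1 + e)))%:E < +oo)%E.
Proof.
move=> e0.
have bound n : \sum_(0 <= k < n) k%:R `^ (- (1 + e)) <= 1 + e^-1 :> R.
  have : forall m, \sum_(0 <= k < m.+2) k%:R `^ (- (1 + e)) <= 1 +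
    e^-1 * (1 - m.+1%:R `^ (- e)) :> R.
    elim=> [|m IH].
      rewrite !big_nat_recr//= big_geq// add0r !powR1 subrr mulr0 addr0.
      by rewrite powR0 ?add0r// oppr_eq0 gt_eqF// addr_gt0.
    rewrite big_nat_recr//=; have := powR_telescope m e0.
    rewrite -ler_pdivlMl// => H; apply: (le_trans (lerD IH H)); lra.
  move=> /(_ n) H; apply: (@le_trans
    _ _ (\sum_(0 <= k < n.+2) k%:R `^ (- (1 + e)))).
    by rewrite !big_nat_recr//= -addrA lerDl addr_ge0// powR_ge0.
  by apply: (le_trans H); rewrite lerD2l ler_piMr ?invr_ge0 ?(ltW e0)//.
apply: (@le_lt_trans _ _ (1 + e^-1)%:E); last exact: ltry.
apply: lime_le; first by apply: is_cvg_nneseries => n _ _;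
  rewrite lee_fin powR_ge0.
by apply: nearW => n; rewrite sumEFin lee_fin.
Qed.
End Riemann.

(** * Noise sums over all segments *)

Section noise.
Context d (Omega : measurableType d) (R : realType) (P : probability Omega R).

Definition segment n (a b : nat) : {set 'I_n} :=
  [set i : 'I_n | (a <= i < b)%N]%SET.

Lemma card_segment n a b : (b <= n)%N -> #|segment n a b| = (b - a)%N.
Proof.
move=> bn; rewrite -sum1_card.
transitivity (\sum_(i < n | (a <= i < b)%N) 1)%N.
  by apply: eq_bigl => i; rewrite inE.
rewrite -[RHS]muln1 -sum_nat_const_nat (big_nat_widen _ _ n)//
  (big_nat_widenl _ 0)//.
by rewrite big_mkord; apply: eq_bigl => i; rewrite andbC.
Qed.

Lemma measure_bigsetU_le (J : Type) (s : seq J) (Q : pred J)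
  (F : J -> set Omega)
    (x : R) : (forall j, measurable (F j)) ->
  (forall j, Q j -> P (F j) <= x%:E)%E ->
  measurable (\big[setU/set0]_(j <- s | Q j) F j) /\
  (P (\big[setU/set0]_(j <- s | Q j) F j) <= (\sum_(j <- s | Q j) x)%:E)%E.
Proof.
move=> mF Fx.
apply: (big_ind2 (fun A y => measurable A /\ (P A <= y%:E)%E)) => //.
- by split=> //; rewrite measure0.
- move=> A y B z [mA Ay] [mB Bz]; split; first exact: measurableU.
  by rewrite EFinD; apply: le_trans (measureU2 P mA mB) _; exact: leeD.
- by move=> j Qj; split=> //; exact: Fx.
Qed.

Variables (xi : forall n : nat, 'I_n -> {RV P >-> R}) (beta e : R).
Hypotheses (A_xi : conditionA xi beta) (beta0 : 0 < beta) (e0 : 0 < e).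

(* With this threshold one segment is bad with probability at most [2 * n ^ -
   (3 + e)]. There are about [n ^ 2] segments, and a summable sequence [n ^ -
   (1 + e)] is left: the 3 here is the source of the constant 12 beta = 3 * 4
   beta in the condition on the penalty. *)
Let threshold n : R := 4 * beta * (3 + e) * ln n%:R.

Let large_segment n (p : 'I_n.+1 * 'I_n.+1) := [set w |
  #|segment n p.1 p.2|%:R * threshold n <
    (\sum_(i in segment n p.1 p.2) xi i w) ^+ 2]%R.

Let large_noise n := \big[setU/set0]_(p : 'I_n.+1 * 'I_n.+1 | (p.1 < p.2)%N)
  large_segment p.

Lemma large_noise_le n : measurable (large_noise n) /\
  (P (large_noise n) <= (8 * n%:R `^ (- (1 + e)))%:E)%E.
Proof.
case: n => [|n].
  rewrite /large_noise big_pred0; last by move=> [i j]; rewrite !ord1.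
  by rewrite measure0 lee_fin mulr_ge0// powR_ge0.
have [_ indep_xi mgf] := A_xi.
have n0 : 0 < n.+1%:R :> R by rewrite ltr0n.
have mls (p : 'I_n.+2 * 'I_n.+2) : measurable (large_segment p).
  exact: measurable_tail.
have tail (p : 'I_n.+2 * 'I_n.+2) : (p.1 < p.2)%N -> (P (large_segment p) <=
    (2 * n.+1%:R `^ (- (3 + e)))%:E)%E.
  move=> p12; rewrite /powR gt_eqF//.
  have -> : - (3 + e) * ln n.+1%:R = - (threshold n.+1 / (4 * beta)).
    by rewrite /threshold; field; rewrite gt_eqF.
  apply: (subgaussian_tail (indep_xi n.+1) beta0 (mgf n.+1)).
    by rewrite card_segment ?subn_gt0// -ltnS.
  by rewrite !mulr_ge0 ?ln_ge0 ?ler1n ?(ltW beta0)// addr_ge0// ltW.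
have [mU PU] := measure_bigsetU_le (index_enum _) mls tail.
split=> //; apply: (le_trans PU); rewrite lee_fin.
rewrite big_mkcond; apply: (@le_trans _ _ (\sum_(p : 'I_n.+2 * 'I_n.+2)
    2 * n.+1%:R `^ (- (3 + e)))).
  by apply: ler_sum => p _; case: ifP => // _; rewrite mulr_ge0// powR_ge0.
rewrite sumr_const card_prod !card_ord -[leLHS]mulr_natr natrM.
have -> : n.+1%:R `^ (- (1 + e)) = n.+1%:R ^+ 2 * n.+1%:R `^ (- (3 + e)) :> R.
  rewrite -powR_mulrn ?(ltW n0)// -powRD ?(gt_eqF n0) ?implybT//.
  by congr (_ `^ _); ring.
have n21 : n.+2%:R <= 2 * n.+1%:R :> R by rewrite -natrM ler_nat mul2n -addnn
  addSn addnS !ltnS leq_addr.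
have := powR_ge0 (n.+1%:R : R) (- (3 + e)).
move: (_ `^ _) => z z0.
have sq : n.+2%:R * n.+2%:R <=
  (2 * n.+1%:R) * (2 * n.+1%:R) :> R by rewrite ler_pM.
have := ler_wpM2r z0 sq; lra.
Qed.

(** Borel-Cantelli for the events that some segment carries a large noise. *)
Lemma noise_eventually_small :
  {ae P, forall w, \forall n \near \oo, forall a b, (a < b)%N -> (b <= n)%N ->
    (\sum_(i < n | (a <= i < b)%N) xi i w) ^+ 2 <=
    (b - a)%:R * (4 * beta * (3 + e) * ln n%:R)}.
Proof.
have mL n := (large_noise_le n).1.
exists (lim_sup_set large_noise); split.
- by apply: bigcap_measurable => // n _; apply: bigcup_measurable => k _;
  exact: mL.
- apply: lim_sup_set_cvg0 => //.
  apply: (@le_lt_trans _ _ (\sum_(n <oo) (8%:E * (n%:R `^ (- (1 + e)))%:E))%E).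
    by apply: lee_nneseries => // n _; rewrite -EFinM;
      exact: (large_noise_le n).2.
  rewrite nneseriesZl//.
  by apply: lte_mul_pinfty; rewrite ?lee_fin//; exact: powR_series_lty.
- move=> w /= H N _; apply: contrapT => HN; apply: H.
  exists N => // n /= Nn a b ab bn; rewrite leNgt; apply/negP => large.
  apply: HN; exists n => //.
  have an : (a < n.+1)%N by rewrite ltnS ltnW// (leq_trans ab).
  rewrite /large_noise (bigD1 (Ordinal an, Ordinal (bn : b < n.+1)%N))//=; left.
  rewrite /large_segment/= card_segment// (lt_le_trans large)//.
  by under [in leRHS]eq_bigl do rewrite inE.
Qed.

End noise.

(** * The rate of convergence *)

Section rate.
Variable R : realType.

Lemma sqnorm_ge0 (h : R -> R) : (0 <= sqnorm h)%E.
Proof. by apply: integral_ge0 => x _; rewrite lee_fin sqr_ge0. Qed.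

Lemma approx_spaceP (alpha : R) f : approx_space alpha f ->
  exists2 S, 0 <= S & forall k, (0 < k)%N -> exists g,
    [/\ step_fun g, (jumps g #<= `I_k)%card &
        (sqnorm (g \- f)%R <= ((S * k%:R `^ (- alpha)) ^+ 2)%:E)%E].
Proof.
move=> [_]; set E := ereal_sup _ => Eoo.
have err0 k : (0 <= approx_err k f)%E.
  by apply: le_ereal_inf_tmp => _ [g _ <-]; exact: Lnorm_ge0.
have Ek k : (0 < k)%N -> ((k%:R `^ alpha)%:E * approx_err k f <= E)%E.
  by move=> k0; apply: ereal_sup_ubound; exists k.
have E0 : (0 <= E)%E.
  by apply: le_trans (Ek 1%N isT); rewrite mule_ge0// lee_fin powR_ge0.
have Efin : E = (fine E)%:E by rewrite fineK// ge0_fin_numE.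
have S0 : 0 <= fine E by rewrite -lee_fin -Efin.
exists (fine E + 1) => [|k k0]; first by rewrite addr_ge0.
have ka0 : 0 < k%:R `^ alpha :> R by rewrite powR_gt0// ltr0n.
have : (approx_err k f < ((fine E + 1) * k%:R `^ (- alpha))%:E)%E.
  apply: (@le_lt_trans _ _ ((k%:R `^ alpha)^-1 * fine E)%:E).
    by rewrite EFinM lee_pdivlMl// -Efin; exact: Ek.
  by rewrite lte_fin powRN mulrC ltr_pM2r ?invr_gt0// ltrDl.
move=> /ereal_inf_lt[_ [g [sg jg] <-] /ltW gf]; exists g; split=> //.
by rewrite -L2norm_le// mulr_ge0 ?powR_ge0// addr_ge0.
Qed.

(** For [k] of order [gamma ^ - 1 / (2 alpha + 1)] the squared approximation
    error [k ^ - 2 alpha] and the penalty [gamma * k] are of the same order. *)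
Lemma balanced_jumps (alpha gamma : R) : 0 < alpha -> 0 < gamma <= 1 ->
  exists2 k, (0 < k)%N &
    (k%:R `^ (- alpha)) ^+ 2 <= (gamma `^ (alpha / (2 * alpha + 1))) ^+ 2 /\
    gamma * k%:R <= 2 * (gamma `^ (alpha / (2 * alpha + 1))) ^+ 2.
Proof.
move=> a0 /andP[g0 g1]; set rho := alpha / (2 * alpha + 1).
have a1 : 0 < 2 * alpha + 1 by rewrite addr_gt0// mulr_gt0.
pose x := gamma `^ (- (2 * alpha + 1)^-1).
have x0 : 0 < x by rewrite powR_gt0.
have x1 : 1 <= x.
  rewrite /x powRN invf_ge1 ?powR_gt0//.
  apply: (@le_trans _ _ (1 `^ (2 * alpha + 1)^-1)); last by rewrite powR1.
  by rewrite ge0_ler_powR ?nnegrE ?invr_ge0// ltW.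
have xa : x `^ (- alpha) = gamma `^ rho.
  by rewrite /x -powRrM; congr (_ `^ _); rewrite /rho; field; rewrite gt_eqF.
have gx : gamma * x = (gamma `^ rho) ^+ 2.
  rewrite -powR_mulrn ?powR_ge0// -powRrM -{1}(powRr1 (ltW g0)) -powRD
    ?(gt_eqF g0) ?implybT//.
  by congr (_ `^ _); rewrite /rho; field; rewrite gt_eqF.
exists (Num.truncn x).+1 => //.
have xk : x < (Num.truncn x).+1%:R by exact: truncnS_gt.
have kx : (Num.truncn x).+1%:R <= 2 * x.
  rewrite -natr1 mulr_natl mulr2n lerD//.
  by rewrite truncn_le// ltW.
split; last by rewrite -gx mulrCA ler_wpM2l// ltW.
rewrite -xa lerXn2r ?nnegrE ?powR_ge0// !powRN lef_pV2 ?posrE ?powR_gt0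
  ?ltr0n//.
by rewrite ge0_ler_powR ?nnegrE ?(ltW a0) ?(ltW x0) ?(ltW xk).
Qed.

(** The rate for one sample, whose noise enters only through its sums over
    segments. The hypothesis with [c1] lets the penalty dominate the error [k /
    n] of discretising a step function with [k] jumps. *)
Lemma potts_rate (alpha th c1 : R) f : 0 < alpha -> approx_space alpha f ->
  0 < th < 1 -> 0 <= c1 ->
  exists C, forall n (gamma T : R) (xi u : 'rV[R]_n),
  (0 < n)%N -> 0 < gamma <= 1 -> n%:R^-1 <= c1 * gamma ->
  T <= th * (n%:R * gamma) ->
  (forall (a b : nat), (a < b)%N -> (b <= n)%N ->
    (\sum_(i < n | (a <= i < b)%N) xi 0 i) ^+ 2 <= (b - a)%:R * T) ->
  argmin_potts gamma (cell_means f n + xi) u ->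
  (L2norm (embed u \- f)%R <=
     (C * gamma `^ (alpha / (2 * alpha + 1)))%:E)%E.
Proof.
move=> a0 fA /andP[th0 th1] c10.
have [S S0 approx] := approx_spaceP fA.
have [M M0 discr] := discretize_approx fA.1.
pose A := 2 * (1 + th ^+ 2) / (1 - th) ^+ 2.
pose B := 2 / (1 - th).
have th1' : 0 < 1 - th by rewrite subr_gt0.
have A1 : 1 <= A.
  rewrite /A ler_pdivlMr ?exprn_gt0// mul1r; nra.
have B0 : 0 <= B by rewrite divr_ge0// ltW.
pose C2 := A * S ^+ 2 + (A * M * c1 + 5 * B) * 2.
have C20 : 0 <= C2.
  have A0 := le_trans ler01 A1.
  apply: addr_ge0; first by rewrite mulr_ge0 ?sqr_ge0.
  by apply: mulr_ge0 => //; apply: addr_ge0; apply: mulr_ge0 => //;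
    exact: mulr_ge0.
exists (Num.sqrt C2) => n gamma T xi u n0 g01 ng Tg noise umin.
have /andP[g0 g1] := g01.
have [k k0 [ka kg]] := balanced_jumps a0 g01.
move: ka kg; set G := gamma `^ _ => ka kg.
have [g [sg jg gf]] := approx k k0.
have [v vk vf] := discr g n k n0 sg jg.
have [c c0 decomp] := sqnorm_embed_decomposition n0 fA.1.
rewrite L2norm_le ?mulr_ge0 ?sqrtr_ge0 ?powR_ge0// exprMn sqr_sqrtr//.
rewrite decomp lee_fin.
have vf' : sqdist v (cell_means f n) + c <= S ^+ 2 * G ^+ 2 + M * (k%:R / n%:R).
  rewrite -lee_fin -decomp (le_trans vf)// EFinD leeD2r// (le_trans gf)//.
  by rewrite lee_fin exprMn ler_wpM2l// sqr_ge0.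
have th01 : 0 < th < 1 by rewrite th0.
have oracle := potts_oracle v n0 th01 Tg noise umin.
rewrite -/A -/B in oracle.
have kn : k%:R / n%:R <= c1 * (2 * G ^+ 2).
  apply: (@le_trans _ _ (k%:R * (c1 * gamma))); first by rewrite ler_wpM2l.
  by rewrite mulrCA ler_wpM2l// mulrC.
have vk' : gamma * (2 * (nb_jumps v)%:R + 1) <= 5 * (2 * G ^+ 2).
  apply: (@le_trans _ _ (5 * (gamma * k%:R))); last by rewrite ler_wpM2l.
  rewrite mulrCA ler_wpM2l ?(ltW g0)//.
  rewrite -!natrM natr1 ler_nat.
  by move: vk k0; clear; rewrite -ltnS; lia.
have F0 : 0 <= G ^+ 2 by exact: sqr_ge0.
rewrite /C2.
have := ler_wpM2l (le_trans ler01 A1) vf'.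
have := ler_wpM2l B0 vk'.
have := ler_wpM2l (mulr_ge0 (le_trans ler01 A1) M0) kn.
have : c <= A * c by rewrite ler_peMl.
move: oracle; rewrite !mulrDl !mulrDr; lra.
Qed.

End rate.

(** Finitely many terms only change the constant. *)
Lemma eventual_bound (R : realType) (Q : nat -> Prop) (a b : nat -> R) (C : R) :
  (\forall n \near \oo, Q n -> a n <= C * b n) ->
  exists C', forall n, Q n -> 0 < b n -> a n <= C' * b n.
Proof.
move=> [N _ aC]; exists (`|C| + \sum_(i < N) `|a i / b i|) => n Qn bn.
rewrite -ler_pdivrMr//; have [Nn|nN] := leqP N n.
  apply: (@le_trans _ _ C); first by rewrite ler_pdivrMr// aC.
  by rewrite (le_trans (ler_norm _))// lerDl sumr_ge0.
apply: (le_trans (ler_norm _)); rewrite (bigD1 (Ordinal nN))//= addrCA lerDl.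
by rewrite addr_ge0// sumr_ge0.
Qed.

Lemma L2norm_embedB_fin_num (R : realType) n (f : R -> R) (u : 'rV[R]_n) :
  (0 < n)%N -> Linfty01 f -> L2norm (embed u \- f) \is a fin_num.
Proof.
move=> n0 fb; rewrite ge0_fin_numE; last exact: Lnorm_ge0.
have [c c0 decomp] := sqnorm_embed_decomposition n0 fb.
have s0 : 0 <= sqdist u (cell_means f n) + c.
  by rewrite -lee_fin -decomp; exact: sqnorm_ge0.
apply: (@le_lt_trans _ _ (Num.sqrt (sqdist u (cell_means f n) + c))%:E);
  last exact: ltry.
by rewrite L2norm_le ?sqrtr_ge0// decomp sqr_sqrtr.
Qed.

Theorem theorem2 (R : realType) (d : measure_display)
  (Omega : measurableType d) (P : probability Omega R)
  (alpha : R) (f : R -> R)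
  (xi : forall n : nat, 'I_n -> {RV P >-> R}) (beta : R)
  (gamma : nat -> {RV P >-> R}) (delta : R)
  (fhat : nat -> Omega -> R -> R) :
  0 < alpha ->
  approx_space alpha f ->
  0 < beta ->
  conditionA xi beta ->
  (forall n w, (0 < n)%N ->
    (embed (n:=n) @` argmin_potts (gamma n w) (observation xi f n w))
      (fhat n w)) ->
  0 < delta ->
  {ae P, forall w, gamma ^~ w @ \oo --> (0 : R)} ->
  {ae P, forall w, \forall n \near \oo,
    (1 + delta) * (12 * beta) * (ln n%:R / n%:R) <= gamma n w} ->
  {ae P, forall w, exists C : R, forall n, (0 < n)%N -> 0 < gamma n w ->
    (L2norm (fhat n w \- f)%R <=
     (C * gamma n w `^ (alpha / (2 * alpha + 1)))%:E)%E}.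
Proof.
move=> a0 fA b0 Axi fhatP d0 gamma_to0 gamma_lb.
(* half of the margin [delta] makes the union bound summable; the other half
   leaves [th < 1] *)
pose e := 3 / 2 * delta.
have e0 : 0 < e by rewrite mulr_gt0.
have noise := noise_eventually_small Axi b0 e0.
pose th := (3 + e) / (3 * (1 + delta)).
have d1 : 0 < 1 + delta by rewrite addr_gt0.
have th01 : 0 < th < 1.
  apply/andP; split; first by rewrite divr_gt0// ?mulr_gt0// addr_gt0.
  by rewrite ltr_pdivrMr ?mulr_gt0// /e; lra.
(* [ln 2] bounds [ln n] from below, so [gamma n] dominates [1 / n] *)
pose c1 : R := ((1 + delta) * (12 * beta) * ln 2)^-1.
have ln2 : 0 < ln 2 :> R by rewrite ln_gt0// ltr1n.
have c1_gt0 : 0 < c1 by rewrite invr_gt0 !mulr_gt0.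
have [C rateC] := potts_rate a0 fA th01 (ltW c1_gt0).
apply: filterS3 noise gamma_to0 gamma_lb => w noise_w to0_w lb_w.
have fhatE n : (0 < n)%N ->
  L2norm (fhat n w \- f) = (fine (L2norm (fhat n w \- f)))%:E.
  move=> n0; have [u _ <-] := fhatP n w n0.
  by rewrite fineK//; exact: L2norm_embedB_fin_num fA.1.
have : \forall n \near \oo, (0 < n)%N /\ 0 < gamma n w ->
    fine (L2norm (fhat n w \- f)) <= C * gamma n w `^ (alpha / (2 * alpha + 1)).
  near=> n => -[n0 g0].
  have n1 : (1 < n)%N by near: n; exact: nbhs_infty_gt.
  have g1 : gamma n w <= 1.
    by apply: ltW; near: n; exact: cvgr_lt to0_w _ ltr01.
  have lb : (1 + delta) * (12 * beta) * (ln n%:R / n%:R) <=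
    gamma n w by near: n.
  rewrite -lee_fin -fhatE//.
  have [u umin <-] := fhatP n w n0.
  have nR0 : 0 < n%:R :> R by rewrite ltr0n.
  apply: (rateC n (gamma n w) (4 * beta * (3 + e) * ln n%:R)
    (\row_i xi n i w)) => //.
  - by rewrite g0.
  - rewrite /c1 mulrC ler_pdivlMr ?mulr_gt0//; apply: le_trans lb.
    rewrite mulrC -[leLHS]mulrA ler_pM2l ?mulr_gt0// ler_pM2r ?invr_gt0//.
    by rewrite ler_ln ?posrE ?ltr0n// ler_nat.
  - rewrite /th; have := ler_wpM2l (ltW nR0) lb.
    have -> : n%:R * ((1 + delta) * (12 * beta) * (ln n%:R / n%:R)) =
      (3 * (1 + delta)) * (4 * beta * ln n%:R) by field; rewrite gt_eqF.
    rewrite -ler_pdivlMl ?mulr_gt0// => lb'.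
    have -> : 4 * beta * (3 + e) * ln n%:R =
      (3 + e) * (4 * beta * ln n%:R) by ring.
    by rewrite -[leRHS]mulrA ler_pM2l// addr_gt0.
  - move=> a b ab bn.
    under eq_bigr do rewrite mxE.
    have H : forall a b, (a < b)%N -> (b <= n)%N ->
     (\sum_(i < n | (a <= i < b)%N) xi n i w) ^+ 2 <=
       (b - a)%:R * (4 * beta * (3 + e) * ln n%:R) by near: n.
    exact: H.
  - rewrite (_ : _ + _ = observation xi f n w)//.
    by apply/rowP => i; rewrite !mxE.
move=> /eventual_bound[C' boundC']; exists C' => n n0 g0.
by rewrite fhatE// lee_fin boundC'// powR_gt0.
Unshelve. all: by end_near.
Qed.
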